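(* There is an absolute constant $A>0$ such that the following holds. Let $G$ be an $n$-vertex graph with diameter $D$ and maximum degree $\Delta>1$, and let $s\in V(G)$ be an arbitrary vertex. Then, with probability at least $1-A/n$, $$\frac{D}{2}\;\le\; h(\mathcal{T}(G,s))\;\le\; 2e\Delta\,(4\ln n+2D)\;\le\;(4e\Delta+8e\Delta\ln\Delta)\,D+16e\Delta .$$
   Context: All graphs are finite, simple, undirected and connected. For a graph $G$ on $n$ vertices and $s\in V(G)$, build random subtrees $T_1,\dots,T_n$ of $G$: $T_1$ is the single vertex $s$, and for $1<i\le n$, $T_i$ is obtained from $T_{i-1}$ by choosing, uniformly at random, an edge of $G$ with exactly one endpoint in $T_{i-1}$ and adding it (with its other endpoint) to $T_{i-1}$. The random spanning tree $T_n$, rooted at $s$, is denoted $\mathcal{T}(G,s)$. The height $h(T)$ of a rooted tree $T$ is the maximum number of edges on a root-to-leaf path. $\ln$ is the natural logarithm. *)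

(* Defs.v *)
From mathcomp Require Import all_boot all_algebra.

Set Implicit Arguments.
Unset Strict Implicit.
Unset Printing Implicit Defensive.

Import GRing.Theory Num.Theory.

(* A graph is a symmetric irreflexive relation [adj] on a finite type [V]. *)

Section Graphs.
Variables (V : finType) (adj : rel V).

Definition connected_graph : Prop := forall u v : V, connect adj u v.

Definition edges : {set {set V}} :=
  [set f : {set V} | [exists u, exists v, adj u v && (f == [set u; v])]].

Definition max_degree : nat := \max_(u : V) #|[set v | adj u v]|.

(* [find] returns the least length of a walk from [u] to [v]; lengths below
   [#|V|] suffice, and the value is [#|V|] if there is no walk. *)
Definition dist (u v : V) : nat :=
  find (fun k => [exists p : k.-tuple V, path adj u p && (last u p == v)])
       (iota 0 #|V|).

Definition diameter : nat := \max_(u : V) \max_(v : V) dist u v.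

End Graphs.

(* A subgraph is a pair (vertex set, edge set). *)
Definition subgraph (V : finType) : finType := ({set V} * {set {set V}})%type.

Section RootedTrees.
Variables (V : finType) (s : V).

Definition tree_adj (t : subgraph V) : rel V :=
  fun u v => (u != v) && ([set u; v] \in t.2).

(* A leaf has no child with respect to the root [s]: a non-root vertex is a
   leaf when its degree is 1, the root only when its degree is 0. *)
Definition is_leaf (t : subgraph V) (v : V) : bool :=
  (v \in t.1) && (#|[set f in t.2 | v \in f]| == (v != s)).

(* Paths do not repeat vertices, hence have fewer than [#|V|] edges. *)
Definition height (t : subgraph V) : nat :=
  \max_(k < #|V| | [exists p : k.-tuple V,
      [&& path (tree_adj t) s p, uniq (s :: p) & is_leaf t (last s p)]]) k.

End RootedTrees.

Section RandomTree.
Variables (R : numFieldType) (V : finType) (adj : rel V) (s : V).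

Definition boundary (t : subgraph V) : {set {set V}} :=
  [set f in edges adj | #|f :&: t.1| == 1].

Definition add_edge (t : subgraph V) (f : {set V}) : subgraph V :=
  (t.1 :|: f, f |: t.2).

Definition step_prob (t t' : subgraph V) : R :=
  (#|[set f in boundary t | add_edge t f == t']|%:R / #|boundary t|%:R)%R.

(* [grow_law i] is the probability mass function of the tree with [i.+1]
   vertices, i.e. after [i] growth steps from the single vertex [s]. *)
Fixpoint grow_law (i : nat) : {ffun subgraph V -> R} :=
  if i is j.+1
  then [ffun t' => (\sum_(t : subgraph V) grow_law j t * step_prob t t')%R]
  else [ffun t' => (t' == ([set s], set0))%:R%R].

Definition random_spanning_tree : {ffun subgraph V -> R} := grow_law #|V|.-1.

End RandomTree.

Definition Prob (R : numFieldType) (S : finType) (mu : {ffun S -> R})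
    (E : pred S) : R := (\sum_(t | E t) mu t)%R.

(* Main.v *)
Require Import Defs.
From mathcomp Require Import all_boot all_order all_algebra.
From mathcomp Require Import boolp reals sequences exp.
From mathcomp Require Import zify lra.

Set Implicit Arguments.
Unset Strict Implicit.
Unset Printing Implicit Defensive.

Import Order.TTheory GRing.Theory Num.Theory.

(** Lower bound. In a spanning tree the root reaches any vertex within [height]
    steps, so two vertices are at distance at most twice the height
    ([diameter_le_height]); this holds with certainty.

    Last inequality. A ball of radius [k] has fewer than [2 * Delta ^ k]
    vertices, so [ln n <= D * ln Delta + 2] ([ln_card_le]).

    Upper bound. If every edge carries an independent exponential clock of
    rate 1, the growth process is first-passage percolation from [s]: from a
    tree with [b] boundary edges the next edge is uniform among them, and comes
    after an exponential time of mean [1 / b]. Real waiting times can be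
    replaced by their conditional means, that is by the discrete clock [x]
    which advances by [1 / b] at each step: both estimates that one makes in
    continuous time become supermartingales of the pair (tree, [x]).

    - The tree fills the graph quickly. Fix for every [v] a walk of length at
      most [D] from [v] to [s], and let [r v] be the number of its steps
      before it meets the tree. With probability at least [1 / b] a growth step
      decreases [r v], so the mean of [2 ^ r v] is multiplied by at most
      [1 - 1 / (2 * b) <= expR (- 1 / (2 * b))]. Hence
      [expR (x / 2) * \sum_(v outside the tree) 2 ^ r v] is a supermartingale,
      with start value at most [n * 2 ^ D]. It stays one when the sum, which
      is empty for a spanning tree, is replaced by its maximum with 1
      ([fill_supermartingale]).
    - The tree deepens slowly. A growth step adds on average at most
      [expR 1 * Delta / b] times the present value to the sum over the tree of
      [expR (depth v)], so with [c = expR 1 * Delta] the product of this sum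
      with [expR (- c * x)] is a supermartingale ([depth_supermartingale]),
      with start value 1.

    Let [tau = 4 * ln n + 2 * D]. On a spanning tree of height more than
    [2 * c * tau], either [x >= tau] and the first supermartingale is at least
    [expR (tau / 2)], or [x <= tau] and the second is at least
    [expR (c * tau)]. By Markov's inequality the first case has probability at
    most [n * 2 ^ D * expR (- tau / 2) <= 1 / n] and the second at most
    [expR (- c * tau) <= 1 / n], so [A = 2] works ([height_bound_prob]). *)

(** * Walks, distances and balls *)

Section Walks.
Variables (V : finType) (adj : rel V).
Implicit Types (u v w s : V) (p q : seq V).

(** Also for walks of length at least [#|V|], because [dist] never exceeds
    [#|V|]. *)
Lemma dist_le_walk u p : path adj u p -> dist adj u (last u p) <= size p.
Proof.
move=> up; rewrite /dist; set a := (X in find X _).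
have [ltpV|leVp] := ltnP (size p) #|V|; last first.
  by apply: leq_trans leVp; rewrite -{2}(size_iota 0 #|V|) find_size.
rewrite leqNgt; apply/negP => /(before_find 0); rewrite nth_iota// add0n.
by move=> /existsP; apply; exists (in_tuple p); rewrite up eqxx.
Qed.

Lemma dist_le_diameter u v : dist adj u v <= diameter adj.
Proof. by apply: leq_trans (leq_bigmax u); exact: (leq_bigmax v). Qed.

Lemma geodesic u v : connect adj u v ->
  exists2 p, path adj u p & last u p = v /\ size p = dist adj u v.
Proof.
case/connectP => p0 /shortenP[p up uniqp _] ->.
have szp : size p < #|V| by rewrite -[_ < _]/(size (u :: p) <= _) -(card_uniqP uniqp) max_card.
rewrite /dist; set a := (X in find X _).
have ha : has a (iota 0 #|V|).
  apply/hasP; exists (size p); first by rewrite mem_iota.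
  by apply/existsP; exists (in_tuple p); rewrite up eqxx.
have := nth_find 0 ha; rewrite nth_iota ?add0n; last first.
  by rewrite -[X in _ < X](size_iota 0) -has_find.
by case/existsP => q /andP[uq /eqP lq]; exists q => //; rewrite size_tuple.
Qed.

Fixpoint ball s k : {set V} :=
  if k is j.+1 then s |: \bigcup_(u in ball s j) [set v | adj u v] else [set s].

Lemma walk_in_ball s p k : path adj s p -> size p <= k -> last s p \in ball s k.
Proof.
elim/last_ind: p k => [|p x IH] [|k] //=; rewrite ?inE ?eqxx ?size_rcons//.
rewrite rcons_path last_rcons ltnS => /andP[sp px] szp; apply/orP; right.
by apply/bigcupP; exists (last s p); rewrite ?IH// inE.
Qed.

Lemma card_bigcup_le (I : finType) (T : finType) (P : {set I})
  (F : I -> {set T}) m :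
  (forall i, i \in P -> #|F i| <= m) -> #|\bigcup_(i in P) F i| <= m * #|P|.
Proof.
move=> Fm; rewrite mulnC -sum_nat_const.
apply: (@leq_trans (\sum_(i in P) #|F i|)); last exact: leq_sum.
elim/big_rec2: _ => [|i m' A _ le]; first by rewrite cards0.
by rewrite (leq_trans (leq_card_setU _ _))// leq_add2l.
Qed.

Lemma degree_le_max u : #|[set v | adj u v]| <= max_degree adj.
Proof. exact: (leq_bigmax u). Qed.

(** The ball has at most [1 + Delta + ... + Delta ^ k] vertices. The strict
    inequality absorbs the centre, which is counted anew at each step of the
    induction. *)
Lemma card_ball_lt s k :
  1 < max_degree adj -> #|ball s k| < 2 * max_degree adj ^ k.
Proof.
move=> D1; elim: k => [|k IH] /=; first by rewrite cards1.
apply: leq_ltn_trans (leq_card_setU _ _) _; rewrite cards1 expnS.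
have := card_bigcup_le (P := ball s k) (fun u _ => degree_le_max u).
set N := #|\bigcup_(_ in _) _|; set X := _ ^ _ in IH *.
by set B := #|ball s k| in IH *; set M := max_degree adj in D1 *; nia.
Qed.

Lemma card_lt_diameter s : connected_graph adj -> 1 < max_degree adj ->
  #|V| < 2 * max_degree adj ^ diameter adj.
Proof.
move=> conn D1; rewrite -cardsT.
apply: leq_ltn_trans (card_ball_lt s (diameter adj) D1).
apply/subset_leq_card/subsetP => v _.
have [p sp [<- szp]] := geodesic (conn s v).
by apply: walk_in_ball => //; rewrite szp dist_le_diameter.
Qed.

End Walks.

(** * The combinatorial shape of the grown trees *)

Section Grown.
Variables (V : finType) (adj : rel V) (s : V).
Hypothesis adjC : symmetric adj.
Hypothesis adj_irr : irreflexive adj.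
Implicit Types (u v w : V) (p q : seq V) (t : subgraph V) (f : {set V}).

Lemma boundaryP t f :
  reflect (exists u w, [/\ adj u w, u \in t.1, w \notin t.1 & f = [set u; w]])
          (f \in boundary adj t).
Proof.
apply: (iffP idP) => [|[u [w [auw ut wt ->]]]]; rewrite !inE.
  case/andP => /existsP[u /existsP[w /andP[auw /eqP->]]].
  have neq : u != w by apply: contraTneq auw => ->; rewrite adj_irr.
  have [ut|ut] := boolP (u \in t.1); have [wt|wt] := boolP (w \in t.1).
  - have /setIidPl-> : [set u; w] \subset t.1.
      by apply/subsetP => x; rewrite !inE => /orP[]/eqP->.
    by rewrite cards2 neq.
  - by move=> _; exists u, w.
  - by move=> _; exists w, u; rewrite adjC setUC.
  - suff -> : [set u; w] :&: t.1 = set0 by rewrite cards0.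
    apply/setP => x; rewrite !inE; apply/negP => /andP[/orP[]/eqP->] xt.
      by rewrite xt in ut.
    by rewrite xt in wt.
apply/andP; split.
  by apply/existsP; exists u; apply/existsP; exists w; rewrite auw eqxx.
suff -> : [set u; w] :&: t.1 = [set u] by rewrite cards1.
apply/setP => x; rewrite !inE.
case: (eqVneq x u) => [->|_] /=; first by rewrite ut.
by case: eqVneq => //= ->; rewrite (negbTE wt).
Qed.

Definition simple_path t p := path (tree_adj t) s p && uniq (s :: p).

(** The last field is the form in which a tree enters the lower bound: the
    height only measures paths that end at leaves, so the path from the root to
    a vertex has to go on to a leaf. Stated for all vertices, this is preserved
    by the addition of an edge: a path that ended at the leaf [u] is prolonged
    to the new leaf. *)
Record grown t : Prop := Grown {
  grown_root : s \in t.1;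
  grown_inside : forall f, f \in t.2 -> f \subset t.1;
  grown_edges : t.2 \subset edges adj;
  grown_leaf : forall v, v \in t.1 ->
    exists2 p, simple_path t p & v \in s :: p /\ is_leaf s t (last s p) }.

Lemma grown_start : grown ([set s], set0).
Proof.
split=> [|f|| v] /=; rewrite ?inE ?sub0set// => /eqP->.
exists [::]; rewrite ?inE ?eqxx //; split=> //.
rewrite /is_leaf !inE /= eqxx /=.
by apply/eqP/eqP; rewrite cards_eq0; apply/eqP/setP => f; rewrite !inE.
Qed.

Lemma tree_adjC t : symmetric (tree_adj t).
Proof. by move=> x y; rewrite /tree_adj eq_sym setUC. Qed.

Section NewEdge.
Variables (t : subgraph V) (u w : V).
Hypotheses (gt : grown t) (auw : adj u w) (ut : u \in t.1) (wt : w \notin t.1).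
Let t' := add_edge t [set u; w].

Lemma new_vertices : t'.1 = w |: t.1.
Proof.
apply/setP => x; rewrite /= !inE; case: (eqVneq x u) => [->|_]/=.
  by rewrite ut !orbT.
by rewrite orbC.
Qed.

Lemma old_edge f : f \in t.2 -> w \notin f.
Proof. by move=> /(grown_inside gt)/subsetP fs; apply: contra wt => /fs. Qed.

Lemma old_tree_adj x y : x != w -> y != w -> tree_adj t' x y = tree_adj t x y.
Proof.
move=> xw yw; rewrite /tree_adj !inE; congr (_ && _).
case: eqP => //= E; have := set22 u w; rewrite -E !inE.
by rewrite eq_sym (negbTE xw) eq_sym (negbTE yw).
Qed.

Lemma new_tree_adj x : tree_adj t' x w -> x = u.
Proof.
rewrite /tree_adj !inE => /andP[xw /orP[/eqP E|/old_edge]]; last first.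
  by rewrite set22.
have := set21 x w; rewrite E !inE (negbTE xw) orbF; exact: eqP.
Qed.

Lemma path_avoiding_new x p : w \notin x :: p ->
  path (tree_adj t') x p = path (tree_adj t) x p.
Proof.
elim: p x => //= y p IH x; rewrite !inE !negb_or => /and3P[wx wy wp].
by rewrite IH ?inE ?negb_or ?wy// old_tree_adj// eq_sym.
Qed.

Lemma new_neq_root : w != s.
Proof. by apply: contraNneq wt => ->; exact: grown_root gt. Qed.

(** The new vertex hangs from [u] alone, so a simple path from the root can
    only meet it at its last step. *)
Lemma simple_path_new p : simple_path t' p ->
  (w \notin p /\ simple_path t p) \/
  (exists q, [/\ p = rcons q w, simple_path t q & last s q = u]).
Proof.
move=> /andP[pth uq]; have [wp|wp] := boolP (w \in p); last first.
  left; split=> //; rewrite /simple_path uq andbT -path_avoiding_new// inE negb_or.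
  by rewrite new_neq_root.
right; case/splitPr: wp pth uq => q p2.
rewrite -cat_cons cat_uniq cat_path /= => /and3P[pq /new_tree_adj lq pw].
move=> /and3P[uqq nqp uqp].
have wq : w \notin s :: q by move: nqp; rewrite negb_or => /andP[].
case: p2 pw nqp {uqp} => [_ _|y p2 /andP[wy _]]; last first.
  have -> : y = u by apply: new_tree_adj; rewrite tree_adjC.
  by rewrite -lq -[has _ _]/((last s q \in s :: q) || _) mem_last /= orbT.
exists q; split=> //; first by rewrite cats1.
by rewrite /simple_path -path_avoiding_new// pq.
Qed.

Lemma simple_path_old p : simple_path t p -> w \notin s :: p /\ simple_path t' p.
Proof.
move=> /andP[pth uq]; suff wp : w \notin s :: p.
  by rewrite /simple_path path_avoiding_new// pth.
have : all (mem t.1) p.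
  elim: p s pth {uq} => //= y p IH x /andP[/andP[_ /(grown_inside gt)/subsetP fs]].
  by move=> /IH->; rewrite andbT fs// set22.
move=> /allP pt; rewrite inE negb_or new_neq_root; apply/negP => /pt.
by rewrite /= (negbTE wt).
Qed.

Lemma simple_path_rcons p :
  simple_path t p -> last s p = u -> simple_path t' (rcons p w).
Proof.
move=> /simple_path_old[wp /andP[pth uq]] lp.
rewrite /simple_path rcons_path pth -rcons_cons rcons_uniq wp uq lp !andbT /=.
rewrite /tree_adj !inE eqxx andbT.
by apply: contraNneq wt => <-.
Qed.

Lemma old_leaf v : v != u -> v != w -> is_leaf s t' v = is_leaf s t v.
Proof.
move=> vu vw; rewrite /is_leaf new_vertices !inE (negbTE vw) /=.
congr (_ && (_ == _)); apply: eq_card => f; rewrite !inE.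
by case: eqVneq => //= ->; rewrite !inE (negbTE vu) (negbTE vw) andbF.
Qed.

Lemma new_leaf : is_leaf s t' w.
Proof.
rewrite /is_leaf new_vertices setU11 new_neq_root /=.
suff -> : [set f in [set u; w] |: t.2 | w \in f] = [set [set u; w]].
  by rewrite cards1.
apply/setP => f; rewrite !inE; case: eqVneq => [->|_]/=; first by rewrite set22.
by apply/negP => /andP[/old_edge/negP].
Qed.

Lemma grown_add_edge : grown t'.
Proof.
have extend p : simple_path t p -> exists2 q, simple_path t' q &
    {subset s :: p <= s :: q} /\ (last s p = u -> last s q = w) /\
    (last s p != u -> last s q = last s p).
  move=> sp; have [lp|lp] := eqVneq (last s p) u.
    exists (rcons p w); first exact: simple_path_rcons.
    split; last by rewrite last_rcons.
    by move=> x; rewrite -rcons_cons mem_rcons inE orbC => ->.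
  exists p; first by have [] := simple_path_old sp.
  by split=> //; split=> // E; rewrite E eqxx in lp.
split.
- by rewrite new_vertices !inE (grown_root gt) orbT.
- move=> f; rewrite new_vertices !inE => /orP[/eqP->|/(grown_inside gt)fs].
    by apply/subsetP => x; rewrite !inE => /orP[]/eqP->; rewrite ?eqxx ?ut ?orbT.
  by apply: (subset_trans fs); exact: subsetUr.
- apply/subsetP => f; rewrite !inE => /orP[/eqP->|/(subsetP (grown_edges gt))].
    by apply/existsP; exists u; apply/existsP; exists w; rewrite auw eqxx.
  by rewrite inE.
- move=> v; rewrite new_vertices !inE => /orP[/eqP->|vt].
    have [p sp [up _]] := grown_leaf gt ut.
    have [q [sq lq]] : exists q, simple_path t q /\ last s q = u.
      move: sp; case/splitPl: up => p1 p2 l1; rewrite /simple_path.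
      rewrite -cat_cons cat_uniq cat_path => /andP[/andP[P1 _] /andP[U1 _]].
      by exists p1; rewrite P1 U1.
    exists (rcons q w); first exact: simple_path_rcons.
    by rewrite -rcons_cons mem_rcons mem_head last_rcons new_leaf.
  have [p sp [vp lf]] := grown_leaf gt vt.
  have [q sq [sub [lu ln]]] := extend p sp.
  exists q => //; split; first exact: sub.
  have [lp|lp] := eqVneq (last s p) u; first by rewrite lu// new_leaf.
  rewrite ln// old_leaf//; apply: contraNneq wt => <-.
  by case/andP: lf.
Qed.

End NewEdge.

Lemma simple_path_size t p : simple_path t p -> size p < #|V|.
Proof. move=> /andP[_ uq].
by rewrite -[_ < _]/(size (s :: p) <= _) -(card_uniqP uq) max_card. Qed.

(** In a tree the maximum is over the only simple path from [s] to [v]. Taken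
    as a maximum, the depth bounds the height at once, and the upper bounds on
    it below come from [simple_path_new]. *)
Definition depth t v : nat :=
  \max_(k < #|V| | [exists p : k.-tuple V, simple_path t p && (last s p == v)]) k.

Lemma depth_ge t p : simple_path t p -> size p <= depth t (last s p).
Proof.
move=> sp.
apply: (leq_bigmax_cond (Ordinal (simple_path_size sp))).
by apply/existsP; exists (in_tuple p); rewrite sp eqxx.
Qed.

Lemma depth_le t v m :
  (forall p, simple_path t p -> last s p = v -> size p <= m) -> depth t v <= m.
Proof.
move=> H; apply/bigmax_leqP => k /existsP[p /andP[sp /eqP lp]].
by rewrite -(size_tuple p) H.
Qed.

Lemma depth_add_old t u w v : grown t -> adj u w -> u \in t.1 -> w \notin t.1 ->
  v \in t.1 -> depth (add_edge t [set u; w]) v <= depth t v.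
Proof.
move=> gt auw ut wt vt; apply: depth_le => p.
move=> /(simple_path_new gt wt)[[_ sp] <-|[q [-> _ _]]].
  exact: depth_ge.
by rewrite last_rcons => wv; rewrite wv vt in wt.
Qed.

Lemma depth_add_new t u w : grown t -> adj u w -> u \in t.1 -> w \notin t.1 ->
  depth (add_edge t [set u; w]) w <= (depth t u).+1.
Proof.
move=> gt auw ut wt; apply: depth_le => p.
move=> /(simple_path_new gt wt)[[wp _] lw|[q [-> sq <-] _]].
  have := mem_last s p; rewrite lw inE (negbTE wp) orbF.
  by rewrite (negbTE (new_neq_root gt wt)).
by rewrite size_rcons ltnS depth_ge.
Qed.

Lemma depth_start : depth ([set s], set0) s = 0.
Proof.
apply/eqP; rewrite -leqn0; apply: depth_le => [[|x p]]//.
by rewrite /simple_path /= /tree_adj !inE andbF.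
Qed.

Lemma height_le_depth t : s \in t.1 ->
  exists2 v, v \in t.1 & height s t <= depth t v.
Proof.
move=> st; have [v vt max_v] := arg_maxnP (depth t) st.
exists v => //; apply/bigmax_leqP => k /existsP[p /and3P[pth uq lf]].
have sp : simple_path t p by rewrite /simple_path pth.
rewrite -(size_tuple p); apply: leq_trans (depth_ge sp) _.
by apply: max_v; case/andP: lf.
Qed.

Lemma tree_adj_sub t u v : grown t -> tree_adj t u v -> adj u v.
Proof.
move=> gt /andP[uv /(subsetP (grown_edges gt))]; rewrite inE.
case/existsP => x /existsP[y /andP[axy /eqP E]].
have : u \in [set x; y] by rewrite -E set21.
have : v \in [set x; y] by rewrite -E set22.
rewrite !inE => /orP[]/eqP ev /orP[]/eqP eu; rewrite eu ev ?eqxx// in uv *.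
by rewrite adjC.
Qed.

Lemma grown_walk t v : grown t -> v \in t.1 ->
  exists2 p, path adj s p & last s p = v /\ size p <= height s t.
Proof.
move=> gt vt; have [p sp [vp lf]] := grown_leaf gt vt.
have szp : size p <= height s t.
  apply: (leq_bigmax_cond (Ordinal (simple_path_size sp))).
  by apply/existsP; exists (in_tuple p); case/andP: (sp) => -> ->.
have {sp}: path adj s p.
  by case/andP: sp => + _; apply: sub_path => x y; exact: tree_adj_sub.
move: szp; case/splitPl: vp => p1 p2 l1.
rewrite size_cat cat_path => szp /andP[P1 _]; exists p1 => //.
by split=> //; apply: leq_trans szp; exact: leq_addr.
Qed.

(** The tree paths from the root to [u] and to [v] make up a walk from [u] to
    [v]. *)
Lemma diameter_le_height t : grown t -> t.1 = setT ->
  diameter adj <= 2 * height s t.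
Proof.
move=> gt tT; apply/bigmax_leqP => u _; apply/bigmax_leqP => v _.
have inT x : x \in t.1 by rewrite tT inE.
have [p sp [lp szp]] := grown_walk gt (inT u).
have [q sq [lq szq]] := grown_walk gt (inT v).
have up : path adj u (rev (belast s p)).
  by rewrite -lp rev_path; under eq_path do rewrite adjC.
have lup : last u (rev (belast s p)) = s.
  by case: (p) lp => //= x p' <-; rewrite rev_cons last_rcons.
have uq : path adj u (rev (belast s p) ++ q) by rewrite cat_path up lup.
have := dist_le_walk uq; rewrite last_cat lup lq => /leq_trans; apply.
by rewrite size_cat size_rev size_belast mul2n -addnn leq_add.
Qed.

(** * Crossing the boundary of the tree *)

(** The number of steps that [p], read as a walk from [v], takes to reach the
    tree. *)
Definition steps_to (A : {set V}) v p : nat := find (mem A) (v :: p).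

Lemma steps_to_sub (A B : {set V}) v p :
  A \subset B -> steps_to B v p <= steps_to A v p.
Proof. by move=> /subsetP AB; apply: sub_find => x /AB. Qed.

(** The last edge of the walk before it enters the tree is a boundary edge. *)
Lemma boundary_on_walk t v p :
  path adj v p -> last v p \in t.1 -> v \notin t.1 ->
  exists2 f, f \in boundary adj t &
             steps_to (add_edge t f).1 v p < steps_to t.1 v p.
Proof.
rewrite /steps_to.
elim: p v => [|x p IH] v /= => [_ ->|/andP[avx xp] lt vt] //.
rewrite (negbTE vt) /=; have [xt|xt] := boolP (x \in t.1).
  exists [set x; v]; last by rewrite /= !inE eqxx !orbT.
  by apply/boundaryP; exists x, v; rewrite adjC.
have [f fb] := IH x xp lt xt; rewrite /= (negbTE xt) => lf.
by exists f => //; case: ifP.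
Qed.

Lemma boundary_card_gt0 t : connected_graph adj -> s \in t.1 -> t.1 != setT ->
  0 < #|boundary adj t|.
Proof.
move=> conn st; rewrite -subTset => /subsetPn[v _ vt].
have [p vp lp] := connectP (conn v s); rewrite lp in st.
have [f fb _] := boundary_on_walk vp st vt.
by apply/card_gt0P; exists f.
Qed.

Lemma card_boundary_at t u :
  #|[set f in boundary adj t | u \in f]| <= max_degree adj.
Proof.
apply: leq_trans (degree_le_max adj u).
apply: leq_trans (leq_imset_card (fun v => [set u; v]) _).
apply/subset_leq_card/subsetP => f; rewrite inE => /andP[/boundaryP].
case=> x [y [axy _ _ ->]]; rewrite !inE => /orP[]/eqP->.
  by apply/imsetP; exists y; rewrite ?inE.
by apply/imsetP; exists x; rewrite ?inE ?(adjC y)// setUC.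
Qed.

End Grown.

(** * Expectations along the growth process *)

Section Process.
Local Open Scope ring_scope.
Variables (R : realType) (V : finType) (adj : rel V) (s : V).
Hypothesis adjC : symmetric adj.
Hypothesis adj_irr : irreflexive adj.
Hypothesis conn : connected_graph adj.
Implicit Types (t : subgraph V) (f : {set V}) (G H : subgraph V -> R -> R).

Definition rate t : R := #|boundary adj t|%:R.

(** One growth step, averaged. The second argument of [G] is a clock, which
    advances by the mean waiting time of a step when every boundary edge rings
    at rate 1. *)
Definition step G t (x : R) : R :=
  (\sum_(f in boundary adj t) G (add_edge t f) (x + (rate t)^-1)) / rate t.

Fixpoint expect i G : R :=
  if i is j.+1 then expect j (step G) else G ([set s], set0) 0.

(** [expect i] integrates over whole trajectories, since the clock depends on
    all the trees met; on functions of the last tree alone it is the mean under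
    the growth law. *)
Lemma expect_grow_law i (g : subgraph V -> R) :
  \sum_t grow_law R adj s i t * g t = expect i (fun t _ => g t).
Proof.
elim: i g => [|i IH] g /=.
  rewrite (bigD1 ([set s], set0))//= ffunE eqxx mul1r big1 ?addr0// => t nt.
  by rewrite ffunE (negbTE nt) mul0r.
transitivity (\sum_t grow_law R adj s i t *
                (\sum_t' step_prob R adj t t' * g t')).
  under eq_bigr do rewrite ffunE mulr_suml.
  rewrite exchange_big; apply: eq_bigr => t _.
  by rewrite mulr_sumr; apply: eq_bigr => t' _; rewrite mulrA.
rewrite IH /step /=; congr (expect i _); apply/funext => t; apply/funext => _.
rewrite /step_prob -/(rate t).
transitivity (\sum_(f in boundary adj t) \sum_t'
                (add_edge t f == t')%:R * g t' / rate t).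
  rewrite exchange_big; apply: eq_bigr => t' _.
  rewrite -mulr_suml -mulr_suml mulrAC; congr (_ * _ / _).
  rewrite -sum1_card natr_sum big_mkcond [RHS]big_mkcond /=.
  apply: eq_bigr => f _; rewrite inE.
  by case: (f \in _) => //=; case: (_ == _).
rewrite mulr_suml; apply: eq_bigr => f _.
rewrite (bigD1 (add_edge t f))//= eqxx mul1r big1 ?addr0// => t' nt.
by rewrite eq_sym (negbTE nt) !mul0r.
Qed.

Definition reached i t := grown adj s t /\ #|t.1| = i.+1.

Lemma reached_start : reached 0 ([set s], set0).
Proof. by split; [exact: grown_start | rewrite cards1]. Qed.

Lemma reached_add_edge i t f : reached i t -> f \in boundary adj t ->
  reached i.+1 (add_edge t f).
Proof.
move=> [gt ct] /(boundaryP adjC adj_irr)[u [w [auw ut wt ->]]].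
split; first exact: grown_add_edge.
by rewrite new_vertices// cardsU1 wt ct.
Qed.

Lemma rate_ge0 t : 0 <= rate t.
Proof. exact: ler0n. Qed.

Lemma rate_ge1 i t : (i.+1 < #|V|)%N -> reached i t -> 1 <= rate t.
Proof.
move=> iV [gt ct]; rewrite ler1n.
apply: (boundary_card_gt0 adjC adj_irr conn (grown_root gt)).
by apply: contraTneq iV => tT; rewrite -leqNgt -ct tT cardsT.
Qed.

Lemma expect_le i G H : (forall t x, reached i t -> G t x <= H t x) ->
  expect i G <= expect i H.
Proof.
elim: i G H => [|i IH] G H GH /=; first exact/GH/reached_start.
apply: IH => t x rt; rewrite ler_wpM2r ?invr_ge0 ?rate_ge0//.
by apply: ler_sum => f fb; apply/GH/reached_add_edge.
Qed.

Definition supermartingale G := forall i t x,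
  (i.+1 < #|V|)%N -> reached i t -> step G t x <= G t x.

(** Optional stopping, in complemented form: as long as the tree does not span,
    there is a boundary edge and the step has total mass 1. *)
Lemma expect_1subr i G :
  (i < #|V|)%N -> supermartingale G ->
  1 - G ([set s], set0) 0 <= expect i (fun t x => 1 - G t x).
Proof.
move=> + sG; elim: i => [|i IH] //= iV.
apply: le_trans (IH (ltnW iV)) _; apply: expect_le => t x rt.
have r0 : rate t != 0 by rewrite gt_eqF// (lt_le_trans ltr01)// (rate_ge1 iV).
rewrite /step sumrB sumr_const -/(rate t) mulrBl divff//.
by rewrite lerB// (sG i).
Qed.

Lemma supermartingale_lincomb (a b : R) G H : 0 <= a -> 0 <= b ->
  supermartingale G -> supermartingale H ->
  supermartingale (fun t x => a * G t x + b * H t x).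
Proof.
move=> a0 b0 sG sH i t x iV rt.
rewrite /step big_split/= mulrDl -!mulr_sumr -!mulrA.
by rewrite lerD// ler_wpM2l//; [exact: sG iV rt | exact: sH iV rt].
Qed.

(** A potential that drifts at relative speed [k] per unit of the clock is
    compensated by [expR (- k * x)], because [1 + y <= expR y]. Both signs of
    [k] are used. *)
Lemma compensated_supermartingale (k : R) (F : subgraph V -> R) :
  (forall t, 0 <= F t) ->
  (forall i t, (i.+1 < #|V|)%N -> reached i t ->
     \sum_(f in boundary adj t) F (add_edge t f) <= (rate t + k) * F t) ->
  supermartingale (fun t x => expR (- k * x) * F t).
Proof.
move=> F0 drift i t x iV rt; rewrite /step -mulr_sumr.
have r1 := rate_ge1 iV rt; have r0 : 0 < rate t by apply: lt_le_trans r1.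
rewrite mulrDr expRD -!mulrA ler_wpM2l ?expR_ge0//.
rewrite mulrA ler_pdivrMr//.
apply: le_trans (ler_wpM2l (expR_ge0 _) (drift i t iV rt)) _.
rewrite mulrA [leRHS]mulrC ler_wpM2r//.
have -> : rate t + k = rate t * (1 + k / rate t).
  by rewrite mulrDr mulr1 mulrCA divff ?gt_eqF// mulr1.
rewrite mulrCA ler_piMr ?rate_ge0// mulNr expRN mulrC.
by rewrite ler_pdivrMr ?expR_gt0// mul1r expR_ge1Dx.
Qed.

(** * Depths grow slowly against the clock *)

Definition depth_weight t : R := \sum_(v in t.1) expR (depth s t v)%:R.

Lemma depth_weight_ge0 t : 0 <= depth_weight t.
Proof. by apply: sumr_ge0 => v _; exact: expR_ge0. Qed.

Lemma depth_weight_add_edge i t f : reached i t -> f \in boundary adj t ->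
  depth_weight (add_edge t f) <=
  depth_weight t + \sum_(u in t.1 | u \in f) expR 1 * expR (depth s t u)%:R.
Proof.
move=> [gt _] /(boundaryP adjC adj_irr)[u [w [auw ut wt ->]]].
rewrite /depth_weight new_vertices// big_setU1//= addrC lerD//.
  apply: ler_sum => v vt; rewrite ler_expR ler_nat.
  exact: depth_add_old gt _ _ _ _.
rewrite (bigD1 u)/=; last by rewrite ut set21.
apply: ler_wpDr; first by apply: sumr_ge0 => v _; rewrite mulr_ge0 ?expR_ge0.
by rewrite -expRD ler_expR [1 + _]addrC natr1 ler_nat (depth_add_new gt).
Qed.

(** Each vertex of the tree has at most [Delta] boundary edges, and an edge
    that is added there creates a vertex one level deeper, of weight [expR 1]
    times as large. *)
Lemma depth_supermartingale :
  supermartingale (fun t x =>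
    expR (- (expR 1 * (max_degree adj)%:R) * x) * depth_weight t).
Proof.
apply: compensated_supermartingale; first exact: depth_weight_ge0.
move=> i t iV rt; rewrite mulrDl.
apply: le_trans (ler_sum _ (fun f => depth_weight_add_edge rt)) _.
rewrite big_split/= sumr_const -[_ *+ _]mulr_natl -/(rate t) lerD2l.
rewrite (exchange_big_dep (mem t.1))/=; last by move=> f u _ /andP[].
rewrite mulr_sumr; apply: ler_sum => u ut.
rewrite sumr_const -[_ *+ _]mulr_natr mulrAC ler_wpM2r ?expR_ge0//.
rewrite ler_wpM2l ?expR_ge0// ler_nat.
apply: leq_trans (card_boundary_at adjC adj_irr t u).
by apply: subset_leq_card; apply/subsetP => f /and3P[fb _ uf]; rewrite inE fb.
Qed.

Lemma expR_height_le t : s \in t.1 -> expR (height s t)%:R <= depth_weight t.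
Proof.
move=> st; have [v vt hv] := height_le_depth st.
rewrite /depth_weight (bigD1 v)//=; apply: ler_wpDr.
  by apply: sumr_ge0 => u _; exact: expR_ge0.
by rewrite ler_expR ler_nat.
Qed.

Lemma depth_weight_start : depth_weight ([set s], set0) = 1.
Proof. by rewrite /depth_weight big_set1 depth_start expR0. Qed.

(** * The tree fills the graph before the clock is large *)

Section Fill.
Variable walk : V -> seq V.
Hypothesis walk_path : forall v, path adj v (walk v).
Hypothesis walk_last : forall v, last v (walk v) = s.

Definition lag (A : {set V}) v : R := 2 ^+ steps_to A v (walk v).

(** The maximum with 1 keeps the potential positive on a spanning tree, where
    the sum is empty. *)
Definition fill_weight t : R := Num.max 1 (\sum_(v in ~: t.1) lag t.1 v).

Lemma lag_ge1 A v : 1 <= lag A v.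
Proof. by rewrite /lag exprn_ege1// ler1n. Qed.

Lemma lag_ge0 A v : 0 <= lag A v.
Proof. by apply: le_trans (lag_ge1 A v). Qed.

Lemma lag_add_edge t f v : lag (add_edge t f).1 v <= lag t.1 v.
Proof. by rewrite /lag ler_weXn2l ?ler1n// steps_to_sub//= subsetUl. Qed.

(** On the right the sum also ranges over the vertex that [f] adds. Its lag is
    then 1, which takes care of the case where the new tree spans and its
    weight is the constant 1. *)
Lemma fill_weight_add_edge i t f : (i.+1 < #|V|)%N -> reached i t ->
  fill_weight (add_edge t f) <= \sum_(v in ~: t.1) lag (add_edge t f).1 v.
Proof.
move=> iV [gt ct]; rewrite /fill_weight ge_max; apply/andP; split.
  have /card_gt0P[v vt] : (0 < #|~: t.1|)%N.
    by rewrite cardsCs setCK ct subn_gt0.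
  rewrite (bigD1 v)//=; apply: ler_wpDr (lag_ge1 _ _).
  by apply: sumr_ge0 => u _; exact: lag_ge0.
rewrite [leRHS](big_setID (~: (add_edge t f).1))/=.
rewrite (setIidPr _) ?setCS ?subsetUl// lerDl.
by apply: sumr_ge0 => u _; exact: lag_ge0.
Qed.

(** One of the boundary edges brings [v] at least one step closer, that is,
    it halves the lag of [v] at least. *)
Lemma lag_drift i t v : reached i t -> v \notin t.1 ->
  \sum_(f in boundary adj t) lag (add_edge t f).1 v <=
  (rate t - 1 / 2) * lag t.1 v.
Proof.
move=> [gt _] vt.
have st : last v (walk v) \in t.1 by rewrite walk_last (grown_root gt).
have [f fb lf] := boundary_on_walk adjC adj_irr (walk_path v) st vt.
have half : lag (add_edge t f).1 v <= 1 / 2 * lag t.1 v.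
  rewrite mul1r mulrC ler_pdivlMr// /lag -exprSr.
  by rewrite ler_weXn2l ?ler1n.
rewrite (bigD1 f)//=.
have le_rest : \sum_(g in boundary adj t | g != f) lag (add_edge t g).1 v
    <= (rate t - 1) * lag t.1 v.
  apply: le_trans (ler_sum _ (fun g _ => lag_add_edge t g v)) _.
  rewrite sumr_const -[_ *+ _]mulr_natl /rate [X in (X%:R - 1)](cardD1 f) fb.
  rewrite natrD addrAC subrr add0r ler_wpM2r ?lag_ge0// ler_nat.
  by apply: subset_leq_card; apply/subsetP => g /andP[gb gf]; apply/andP.
by move: half le_rest; set a := lag _ _; set b := \sum_(_ in _ | _) _; nra.
Qed.

Lemma fill_supermartingale :
  supermartingale (fun t x => expR (- (- (1 / 2)) * x) * fill_weight t).
Proof.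
apply: compensated_supermartingale => [t|i t iV rt].
  by rewrite /fill_weight le_max ler01.
apply: (@le_trans _ _ (\sum_(v in ~: t.1) (rate t - 1 / 2) * lag t.1 v)).
  apply: le_trans (ler_sum _ (fun f _ => fill_weight_add_edge f iV rt)) _.
  rewrite exchange_big /=; apply: ler_sum => v; rewrite inE.
  exact: lag_drift rt.
rewrite -mulr_sumr ler_wpM2l ?le_max ?lexx ?orbT//.
by have := rate_ge1 iV rt; lra.
Qed.

Lemma fill_weight_start D : (forall v, size (walk v) <= D)%N ->
  fill_weight ([set s], set0) <= #|V|%:R * 2 ^+ D.
Proof.
move=> wD; rewrite /fill_weight ge_max; apply/andP; split.
  rewrite -natrX -natrM ler1n muln_gt0 expn_gt0 andbT.
  by apply/card_gt0P; exists s.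
apply: (@le_trans _ _ (\sum_(v in ~: [set s]) 2 ^+ D)).
  apply: ler_sum => v _; rewrite /lag ler_weXn2l ?ler1n//.
  apply: leq_trans (wD v); rewrite /steps_to -ltnS -[X in (_ < X)%N]/(size (v :: walk v)).
  by rewrite -has_find; apply/hasP; exists s; [rewrite -(walk_last v) mem_last | rewrite /= inE].
rewrite sumr_const -[_ *+ _]mulr_natl ler_wpM2r ?exprn_ge0// ler_nat.
exact: max_card.
Qed.

End Fill.

End Process.

(** * The three inequalities *)

Section Bounds.
Local Open Scope ring_scope.
Variables (R : realType) (V : finType) (adj : rel V) (s : V).
Hypothesis adjC : symmetric adj.
Hypothesis adj_irr : irreflexive adj.
Hypothesis conn : connected_graph adj.

Lemma ln_card_le : (1 < max_degree adj)%N ->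
  ln (#|V|%:R : R) <= (diameter adj)%:R * ln (max_degree adj)%:R + 2.
Proof.
move=> D1; have V0 : (0 < #|V|)%N by apply/card_gt0P; exists s.
have M0 : (0 : R) < (max_degree adj)%:R by rewrite ltr0n (ltnW D1).
have le : (#|V|%:R : R) <= 2 * (max_degree adj)%:R ^+ diameter adj.
  by rewrite -natrX -natrM ler_nat ltnW// (card_lt_diameter s).
apply: (@le_trans _ _ (ln (2 * (max_degree adj)%:R ^+ diameter adj))).
  by rewrite ler_ln ?posrE ?ltr0n// mulr_gt0// exprn_gt0.
rewrite lnM ?posrE ?exprn_gt0// lnXn// mulr_natl addrC lerD2l.
exact/ltW/ln_sublinear.
Qed.

(** The event [E] need only contain the spanning trees of small height: growth
    from [s] produces no others, and the rest of the theorem's event is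
    certain. *)
Lemma height_bound_prob (E : pred (subgraph V)) :
  let n : R := #|V|%:R in
  let D : R := (diameter adj)%:R in
  let c : R := expR 1 * (max_degree adj)%:R in
  let tau : R := 4 * ln n + 2 * D in
  (0 < max_degree adj)%N ->
  (forall t, grown adj s t -> t.1 = setT ->
     (height s t)%:R <= 2 * c * tau -> E t) ->
  1 - 2 / n <= Prob (random_spanning_tree R adj s) E.
Proof.
move=> n D c tau D1 hE.
have V0 : (0 < #|V|)%N by apply/card_gt0P; exists s.
have expR_ge1 (y : R) : (1 <= expR y) = (0 <= y) by rewrite -expR0 ler_expR.
have n1 : 1 <= n by rewrite ler1n.
have n0 : 0 < n by apply: lt_le_trans n1.
have ln0 : 0 <= ln n by exact: ln_ge0.
have D0 : 0 <= D by exact: ler0n.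
have c1 : 1 <= c.
  by rewrite /c mulr_ege1 ?ler1n// expR_ge1.
have tau0 : ln n <= tau by rewrite /tau; lra.
have [walk walkP] : exists walk : V -> seq V, forall v,
    [/\ path adj v (walk v), last v (walk v) = s
      & (size (walk v) <= diameter adj)%N].
  apply: (@fin_all_exists _ _ (fun v p =>
    [/\ path adj v p, last v p = s & (size p <= diameter adj)%N])) => v.
  have [p vp [lp szp]] := geodesic (conn v s).
  by exists p; split; rewrite // szp dist_le_diameter.
have wp v : path adj v (walk v) by case: (walkP v).
have wl v : last v (walk v) = s by case: (walkP v).
have ws v : (size (walk v) <= diameter adj)%N by case: (walkP v).
(* Two supermartingales, each scaled so that it is at least 1 in one of the
   two cases where the height is large. *)
pose G t x := expR (- (tau / 2)) * (expR (- - (1 / 2) * x) * fill_weight R walk t)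
            + expR (- (c * tau)) * (expR (- c * x) * depth_weight R s t).
have superG : supermartingale adj s G.
  apply: supermartingale_lincomb; rewrite ?expR_ge0//.
    exact: fill_supermartingale.
  exact: depth_supermartingale.
have -> : Prob (random_spanning_tree R adj s) E
    = expect adj s #|V|.-1 (fun t _ => (E t)%:R).
  rewrite -expect_grow_law /Prob big_mkcond; apply: eq_bigr => t _.
  by case: (E t); rewrite ?mulr1 ?mulr0.
have Vlt : (#|V|.-1 < #|V|)%N by rewrite prednK.
apply: (@le_trans _ _ (1 - G ([set s], set0) 0)); last first.
  apply: le_trans (expect_1subr adjC adj_irr conn Vlt superG) _.
  apply: expect_le => // t x [gt ct].
  have tT : t.1 = setT by apply/eqP; rewrite eqEcard subsetT cardsT /= ct prednK.
  have fill1 : 1 <= fill_weight R walk t by rewrite /fill_weight le_max lexx.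
  have dw := expR_height_le R (grown_root gt).
  have T1 : 0 <= expR (- (tau / 2)) * (expR (- - (1 / 2) * x) * fill_weight R walk t).
    by rewrite !mulr_ge0 ?expR_ge0 ?(le_trans ler01 fill1).
  have T2 : 0 <= expR (- (c * tau)) * (expR (- c * x) * depth_weight R s t).
    by rewrite !mulr_ge0 ?expR_ge0 ?depth_weight_ge0.
  have [Et|nEt] := boolP (E t); first by rewrite gerBl addr_ge0.
  have high : 2 * c * tau < (height s t)%:R.
    by rewrite ltNge; apply: contra nEt; exact: hE.
  (* A late clock makes the first term large; an early one, the second. *)
  rewrite subr_le0 /G; have [taux|xtau] := leP tau x.
    apply: ler_wpDr => //; rewrite mulrA -expRD.
    apply: mulr_ege1 => //; rewrite expR_ge1; lra.
  apply: ler_wpDl => //; rewrite mulrA -expRD.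
  apply: le_trans (ler_wpM2l (expR_ge0 _) dw); rewrite -expRD expR_ge1.
  by move: high xtau c1; nra.
rewrite lerB// /G !mulr0 expR0 !mul1r depth_weight_start mulr1.
have en : expR (- ln n) = n^-1 by rewrite expRN lnK// posrE.
have -> : 2 / n = n^-1 + n^-1 by rewrite mulrDl mul1r.
rewrite -en lerD//; last by rewrite ler_expR; move: tau0 c1 ln0; nra.
apply: le_trans (ler_wpM2l (expR_ge0 _) (fill_weight_start R wl ws)) _.
have two_le_e : 2 <= expR 1 :> R by apply: le_trans (expR_ge1Dx 1); lra.
have pow_le : 2 ^+ diameter adj <= expR D.
  by rewrite /D -[X in expR X]mul1r expRM_natr lerXn2r ?nnegrE ?expR_ge0.
apply: le_trans (ler_wpM2l (expR_ge0 _) (ler_wpM2l (ltW n0) pow_le)) _.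
rewrite -[X in X * expR D](@lnK R) ?posrE// -!expRD ler_expR /tau; lra.
Qed.

End Bounds.

Local Open Scope ring_scope.

Theorem theorem1 (R : realType) :
  exists A : R, 0 < A /\
    forall (V : finType) (adj : rel V) (s : V),
      symmetric adj -> irreflexive adj -> connected_graph adj ->
      (1 < max_degree adj)%N ->
      let n : R := #|V|%:R in
      let D : R := (diameter adj)%:R in
      let Delta : R := (max_degree adj)%:R in
      let e : R := expR 1 in
      1 - A / n <=
      Prob (random_spanning_tree R adj s)
        (fun t =>
          let h : R := (height s t)%:R in
          [&& D / 2 <= h,
              h <= 2 * e * Delta * (4 * ln n + 2 * D) &
              2 * e * Delta * (4 * ln n + 2 * D) <=
                (4 * e * Delta + 8 * e * Delta * ln Delta) * D
                + 16 * e * Delta]).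
Proof.
exists 2; split; first by [].
move=> V adj s adjC adj_irr conn D1; cbv zeta.
apply: height_bound_prob => //; first exact: ltnW.
move=> t gt tT hle; apply/and3P; split.
- rewrite ler_pdivrMr// mulrC -natrM ler_nat.
  exact: (diameter_le_height adjC gt tT).
- by apply: le_trans hle _; rewrite mulrA.
- have lnn := ln_card_le R s conn D1.
  have k0 : 0 <= 8 * expR 1 * (max_degree adj)%:R :> R.
    by rewrite !mulr_ge0 ?expR_ge0 ?ler0n.
  by have := ler_wpM2l k0 lnn; lra.
Qed.
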